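(* Let $\mathcal V$ be a multiplicative Poisson vertex algebra, and let $L(S)\in\mathcal V((S^{-1}))$ or $L(S)\in\mathcal V((S))$ be a pseudodifference operator. Assume that $L(S)$ satisfies, with respect to the $\lambda$-bracket of $\mathcal V$ (denoted $\{\cdot\,_\lambda\,\cdot\}_2^{(L)}$), the multiplicative 2-Adler identity $$\{L(z)_\lambda L(w)\}_2^{(L)}=L(w\lambda S)\,\delta_+\Big(\frac{w\lambda S}{z}\Big)L^*\Big(\frac{\lambda}{z}\Big)-L(z)\,\delta_+\Big(\frac{w\lambda S}{z}\Big)L(w)-\frac12\big(L(w\lambda S)+L(w)\big)\Big(L^*\Big(\frac\lambda z\Big)-L(z)\Big)$$ (respectively, with respect to the $\lambda$-bracket of $\mathcal V$, denoted $\{\cdot\,_\lambda\,\cdot\}_1^{(L)}$, the 1-Adler identity $$\{L(z)_\lambda L(w)\}_1^{(L)}=\delta_+\Big(\frac{w\lambda S}z\Big)\Big(\frac{w\lambda S}zL^*\Big(\frac\lambda z\Big)-L(w)\Big)-\Big(L(z)\frac{w\lambda}z-L(w\lambda)\Big)\delta_+\Big(\frac{w\lambda}z\Big)\;).$$ Define $h_n\in\mathcal V$, $n\in\mathbb Z_{\ge0}$, by $h_n=-\frac1n\,\mathrm{mRes}_zL^n(z)$ for $n\neq0$ and $h_0=0$. Then: (a) All the elements $\int h_n$ are Hamiltonian functionals in involution: $\{\int h_m,\int h_n\}_2^{(L)}=0$ (respectively $\{\int h_m,\int h_n\}_1^{(L)}=0$) for all $m,n\in\mathbb Z_{\ge0}$.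 (b) The corresponding hierarchy of compatible Hamiltonian equations satisfies $$\frac{dL(w)}{dt_n}=\{\textstyle\int h_n,L(w)\}_2^{(L)}=[(L^n)_+,L](w),\quad n\in\mathbb Z_{\ge0}$$ (respectively, $\frac{dL(w)}{dt_n}=\{\int h_n,L(w)\}_1^{(L)}=[(L^{n-1})_+,L](w)$, $n\in\mathbb Z_{\ge1}$), and the Hamiltonian functionals $\int h_n$, $n\in\mathbb Z_{\ge0}$, are integrals of motion of all these equations.
   Context: The base field $\mathbb F$ has characteristic $0$. A multiplicative Poisson vertex algebra (mPVA) is a unital commutative associative algebra $\mathcal V$ with an automorphism $S$ and a linear map $\mathcal V\otimes\mathcal V\to\mathcal V[\lambda,\lambda^{-1}]$, $a\otimes b\mapsto\{a_\lambda b\}$, satisfying: $\{S(a)_\lambda b\}=\lambda^{-1}\{a_\lambda b\}$, $\{a_\lambda S(b)\}=\lambda S\{a_\lambda b\}$; $\{a_\lambda bc\}=\{a_\lambda b\}c+\{a_\lambda c\}b$; $\{b_\lambda a\}=-\sum_nS^{-n}(c_n)\lambda^{-n}$ if $\{a_\lambda b\}=\sum_nc_n\lambda^n$; $\{a_\lambda\{b_\mu c\}\}-\{b_\mu\{a_\lambda c\}\}=\{\{a_\lambda b\}_{\lambda\mu}c\}$. Hamiltonian functionals are elements of $\mathcal V/(S-1)\mathcal V$, with quotient map $\int$. It carries the Lie bracket $\{\int a,\int b\}=\int\{a_\lambda b\}|_{\lambda=1}$, and acts on $\mathcal V$ by derivations commuting with $S$ by $\{\int a,b\}=\{a_\lambda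 b\}|_{\lambda=1}$. The Hamiltonian equation of $\int h$ is $\frac{du}{dt}=\{\int h,u\}$, $u\in\mathcal V$; $\int g$ is an integral of motion if $\{\int h,\int g\}=0$; Hamiltonian equations are compatible if the corresponding derivations commute. $\{\int h,L(w)\}$ means the action on the coefficients of $L(w)$. $\mathcal V((S^{\pm1}))$ means $\mathcal V((S))$ or $\mathcal V((S^{-1}))$, with coefficients on the left and product determined by $S\circ f=S(f)S$. For $A(S)=\sum_na_nS^n$: symbol $A(z)=\sum_na_nz^n$, formal adjoint $A^*(S)=\sum_nS^{-n}\circ a_n$, positive part $A_+=\sum_{n\ge0}a_nS^n$, $\mathrm{mRes}_zA(z)=a_0$; $L^n(z)$ is the symbol of the $n$-th power of $L(S)$, and $[A,B](w)$ is the symbol of the commutator. $\delta_+(x)=\sum_{k\ge0}x^k$. In the Adler identities, for $L(S)=\sum_nu_nS^n$: $L(w\lambda S)=\sum_nu_nw^n\lambda^nS^n$, $L^*(\lambda/z)=\sum_nS^{-n}(u_n)\lambda^{-n}z^n$, $\delta_+(w\lambda S/z)=\sum_{k\ge0}w^k\lambda^kz^{-k}S^k$, each $S$ acts on all coefficients written to its right, and $\{L(z)_\lambda L(w)\}=\sum_{i,j}\{{u_i}_\lambda u_j\}z^iw^j$. *)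

(* Defs.v *)
From HB Require Import structures.
From mathcomp Require Import all_boot all_order all_algebra.
From mathcomp Require Import generic_quotient ring_quotient.
From mathcomp Require Import finmap boolp classical_sets functions cardinality fsbigop.

Set Implicit Arguments.
Unset Strict Implicit.
Unset Printing Implicit Defensive.

Import Order.TTheory GRing.Theory Num.Theory.
Local Open Scope classical_set_scope.
Local Open Scope ring_scope.
Local Open Scope quotient_scope.

(* Sums [\sum_(i \in A) F i] are those of fsbigop: the sum of the nonzero
   [F i] with [i] in [A], and 0 when infinitely many of them are nonzero.     *)

Definition iterz (T : Type) (f finv : T -> T) (n : int) (x : T) : T :=
  match n with
  | Posz k => iter k f x
  | Negz k => iter k.+1 finv x
  end.

(* [br a b n] is the coefficient of lambda^n in {a_lambda b}, and the axioms
   are the mPVA axioms read off coefficientwise.  In [br_jacobi], m and n are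
   the exponents of lambda and mu: if {a_lambda b} = \sum_k d_k lambda^k then
   {{a_lambda b}_{lambda mu} c} = \sum_(k, p) {d_k _(p) c} lambda^(k+p) mu^p. *)
Record mPVA (F : fieldType) := MPVA {
  carrier :> comAlgType F;
  shift : {lrmorphism carrier -> carrier};
  unshift : carrier -> carrier;
  br : carrier -> carrier -> int -> carrier;
  shiftK : cancel shift unshift;
  unshiftK : cancel unshift shift;
  br_finite : forall a b, finite_set [set n | br a b n != 0];
  br_linearl : forall (c : F) a a' b n,
    br (c *: a + a') b n = c *: br a b n + br a' b n;
  br_linearr : forall (c : F) a b b' n,
    br a (c *: b + b') n = c *: br a b n + br a b' n;
  br_shiftl : forall a b n, br (shift a) b n = br a b (n + 1);
  br_shiftr : forall a b n, br a (shift b) n = shift (br a b (n - 1));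
  br_leibniz : forall a b c n, br a (b * c) n = br a b n * c + br a c n * b;
  br_skew : forall a b n, br b a n = - iterz shift unshift n (br a b (- n));
  br_jacobi : forall a b c m n,
    br a (br b c n) m - br b (br a c m) n = br (br a b (m - n)) c n
}.

Arguments shift {F V} : rename.
Arguments unshift {F V} : rename.
Arguments br {F V} : rename.

Section HamiltonianFunctionals.
Variables (F : fieldType) (V : mPVA F).
Implicit Types a b k : V.

Definition shz (n : int) : V -> V := iterz (@shift F V) (@unshift F V) n.

Definition im_shiftB1 : {pred V} :=
  fun a => `[< exists k : V, a = shift k - k >].

Lemma im_shiftB1_zmod : zmod_closed im_shiftB1.
Proof.
split=> [|a b]; first by apply/asboolP; exists 0; rewrite raddf0 subr0.
move=> /asboolP[k ->] /asboolP[l ->]; apply/asboolP; exists (k - l).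
by rewrite (linearB shift) !opprD !opprK addrACA.
Qed.

HB.instance Definition _ := GRing.isZmodClosed.Build V im_shiftB1 im_shiftB1_zmod.

Definition functional : zmodType := Quotient.quot im_shiftB1.

Definition fint (a : V) : functional := \pi_(Quotient.quot im_shiftB1) a.

(* {a_lambda b} at lambda = 1 *)
Definition br1 a b : V := \sum_(n \in [set: int]) br a b n.

(* The action {\int a, b} and the Lie bracket {\int a, \int b}; [ham_act_fint] and
   [ham_br_fint] below show that they do not depend on the representatives.      *)
Definition ham_act (f : functional) (b : V) : V := br1 (repr f) b.

Definition ham_br (f g : functional) : functional :=
  fint (br1 (repr f) (repr g)).

Lemma br_Bl a a' b n : br (a - a') b n = br a b n - br a' b n.
Proof. by rewrite addrC -scaleN1r br_linearl scaleN1r addrC. Qed.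

Lemma br_Br a b b' n : br a (b - b') n = br a b n - br a b' n.
Proof. by rewrite addrC -scaleN1r br_linearr scaleN1r addrC. Qed.

Let br1E a b (r : {fset int}) : (forall n, n \notin r -> br a b n = 0) ->
  br1 a b = \sum_(n <- r) br a b n.
Proof. by move=> r0; rewrite /br1 (fsbigTE r). Qed.

Let supp a b : {fset int} := fset_set [set n | br a b n != 0].

Let suppP a b n : n \notin supp a b -> br a b n = 0.
Proof.
rewrite in_fset_set; last exact: br_finite.
by move=> /negP; rewrite inE /= => /negP; rewrite negbK => /eqP.
Qed.

Lemma br1_Bl a a' b : br1 (a - a') b = br1 a b - br1 a' b.
Proof.
pose r := (supp a b `|` supp a' b)%fset.
have out n : n \notin r -> br a b n = 0 /\ br a' b n = 0.
  by rewrite inE negb_or => /andP[/suppP-> /suppP->].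
rewrite !(@br1E _ _ r) => [|n /out[]//|n /out[]//|n /out[]].
  by rewrite -sumrB; apply: eq_bigr => n _; rewrite br_Bl.
by rewrite br_Bl => -> ->; rewrite subr0.
Qed.

Lemma br1_Br a b b' : br1 a (b - b') = br1 a b - br1 a b'.
Proof.
pose r := (supp a b `|` supp a b')%fset.
have out n : n \notin r -> br a b n = 0 /\ br a b' n = 0.
  by rewrite inE negb_or => /andP[/suppP-> /suppP->].
rewrite !(@br1E _ _ r) => [|n /out[]//|n /out[]//|n /out[]].
  by rewrite -sumrB; apply: eq_bigr => n _; rewrite br_Br.
by rewrite br_Br => -> ->; rewrite subr0.
Qed.

Let addz_bij (c : int) : set_bij [set: int] [set: int] (fun n => n + c).
Proof.
split=> // [m n _ _ /addIr //|n _]; exists (n - c) => //=; exact: subrK.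
Qed.

Lemma br1_shiftl a b : br1 (shift a) b = br1 a b.
Proof.
rewrite /br1 [RHS](reindex_fsbig _ _ _ _ (addz_bij 1)).
by apply: eq_fsbigr => n _; rewrite br_shiftl.
Qed.

Lemma br1_shiftr a b : br1 a (shift b) = shift (br1 a b).
Proof.
rewrite (br1E (suppP (a := a) (b := b))) linear_sum /=.
rewrite /br1 (reindex_fsbig _ _ _ _ (addz_bij 1)) (fsbigTE (supp a b)).
  by apply: eq_bigr => n _; rewrite br_shiftr addrK.
by move=> n /suppP an0; rewrite br_shiftr addrK an0 linear0.
Qed.

Let repr_fint a : exists k : V, repr (fint a) = a - (k - shift k).
Proof.
have : repr (fint a) - a \in im_shiftB1.
  by rewrite Quotient.idealrBE /fint reprK.
by move=> /asboolP[k E]; exists k; rewrite opprB -E addrC subrK.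
Qed.

Lemma ham_act_fint a b : ham_act (fint a) b = br1 a b.
Proof.
have [k E] := repr_fint a.
by rewrite /ham_act E !br1_Bl br1_shiftl subrr subr0.
Qed.

Lemma ham_br_fint a b : ham_br (fint a) (fint b) = fint (br1 a b).
Proof.
have [k E] := repr_fint b.
rewrite /ham_br -/(ham_act _ _) ham_act_fint E !br1_Br br1_shiftr opprB; apply/eqP; rewrite -Quotient.idealrBE addrC addKr.
by apply/asboolP; exists (br1 a k).
Qed.

Definition compatible (f g : functional) : Prop :=
  forall u : V, ham_act f (ham_act g u) = ham_act g (ham_act f u).

Definition integral_of_motion (h g : functional) : Prop := ham_br h g = 0.

End HamiltonianFunctionals.

Section PseudoDifference.
Variables (F : fieldType) (V : mPVA F).

(* [A : pdop] stands for \sum_n (A n) S^n, and equally for its symbol.        *)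
Definition pdop := int -> V.
Implicit Types A B L : pdop.

Definition in_VSm A := exists N : int, forall n, N < n -> A n = 0.
Definition in_VSp A := exists N : int, forall n, n < N -> A n = 0.

(* The sum is finite as soon as A and B are both in V((S)), or both in
   V((S^-1)).                                                                 *)
Definition pmul A B : pdop :=
  fun n => \sum_(i \in [set: int]) A i * shz i (B (n - i)).

Definition pone : pdop := fun n => (n == 0)%:R.

Definition pexp A (n : nat) : pdop := iter n (pmul A) pone.

Definition ppos A : pdop := fun n => if 0 <= n then A n else 0.

Definition pcomm A B : pdop := fun n => pmul A B n - pmul B A n.

(* \sum_n S^-n o (A n) = \sum_n S^-n(A n) S^-n *)
Definition padj A : pdop := fun n => shz n (A (- n)).

Definition mRes A : V := A 0.

Definition hdens L (n : nat) : V :=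
  if n == 0%N then 0 else - ((n%:R : F)^-1 *: mRes (pexp L n)).

Definition ham_act_symbol (f : functional V) A : pdop := fun j => ham_act f (A j).

End PseudoDifference.

Section Adler.
Variables (F : fieldType) (V : mPVA F).

(* Exponents (i, j, l, s) of the monomial z^i w^j lambda^l S^s; they are
   written additively.  A function [mono -> V] is a formal series in these
   monomials, coefficients on the left, with S o f = S(f) S.                  *)
Definition mono : zmodType := (int * int * int * int)%type.
Definition mz : mono := (1, 0, 0, 0).
Definition mw : mono := (0, 1, 0, 0).
Definition ml : mono := (0, 0, 1, 0).
Definition mS : mono := (0, 0, 0, 1).

Definition dist := mono -> V.

(* All products occurring in the Adler identities are finite sums.            *)
Definition dmul (A B : dist) : dist :=
  fun e => \sum_(d \in [set: mono]) A d * shz d.2 (B (e - d)).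

Definition dmono (x : mono) : dist := fun e => (e == x)%:R.

(* \sum_n (a n) x^n, for a monomial x *)
Definition subst (a : int -> V) (x : mono) : dist :=
  fun e => \sum_(n \in [set n | x *~ n = e]) a n.

Definition delta_plus : int -> V := fun k => if 0 <= k then 1 else 0.

(* Coefficient of z^i w^j lambda^l in A applied to 1: S has acted on all the
   coefficients written to its right.                                         *)
Definition applied (A : dist) (i j l : int) : V :=
  \sum_(s \in [set: int]) A (i, j, l, s).

Local Notation "A ** B" := (dmul A B) (at level 40, left associativity).

Definition adler2_rhs (L : pdop V) : dist :=
  subst L (mw + ml + mS) ** subst delta_plus (mw + ml + mS - mz)
    ** subst (padj L) (ml - mz)
  \- subst L mz ** subst delta_plus (mw + ml + mS - mz) ** subst L mw
  \- (2%:R^-1 : F) \*: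
      ((subst L (mw + ml + mS) \+ subst L mw)
        ** (subst (padj L) (ml - mz) \- subst L mz)).

Definition adler1_rhs (L : pdop V) : dist :=
  subst delta_plus (mw + ml + mS - mz)
    ** (dmono (mw + ml + mS - mz) ** subst (padj L) (ml - mz)
         \- subst L mw)
  \- (subst L mz ** dmono (mw + ml - mz) \- subst L (mw + ml))
    ** subst delta_plus (mw + ml - mz).

Definition adler2 (L : pdop V) : Prop := forall i j l : int,
  br (L i) (L j) l = applied (adler2_rhs L) i j l.

Definition adler1 (L : pdop V) : Prop := forall i j l : int,
  br (L i) (L j) l = applied (adler1_rhs L) i j l.

End Adler.

(* Main.v *)
(* The Leibniz rule in the first argument, the
   invariance of {\int a, .} under S and the cyclicity of \int mRes give
     {\int mRes L^n, c} = n \sum_i \sum_l {L_i lambda c}_l S^l (S^i (L^(n-1))_(-i)),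
   where {.}_l is the coefficient of lambda^l.  The Adler identity, read off
   coefficientwise, is a difference of two terms L_(i+l) S^l(L_(j-l)) cut off by
   l <= j - i and by 0 <= l, plus four terms which cancel in pairs because L
   commutes with L^(n-1); the two cut-offs produce L (L^n)_+ and (L^n)_+ L.  The
   1-Adler identity is handled likewise.  Then {\int h_m, .} is a derivation
   commuting with S, so {\int h_m, L^n} = [(L^m)_+, L^n], whose residue lies in
   (S - 1)V; hence the involution, and compatibility by the Jacobi identity. *)
Require Import Defs.
From HB Require Import structures.
From mathcomp Require Import all_boot all_order all_algebra.
From mathcomp Require Import ring_quotient.
From mathcomp Require Import finmap boolp classical_sets cardinality fsbigop.
From mathcomp Require Import zify ring.

Set Implicit Arguments.
Unset Strict Implicit.
Unset Printing Implicit Defensive.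

Section Proofs.
Import Order.TTheory GRing.Theory Num.Theory.
Local Open Scope classical_set_scope.
Local Open Scope ring_scope.

(** * Sums over the integers *)

Section IntegerSums.
Variable W : zmodType.
Implicit Types (f g : int -> W) (h : int -> int -> W).

Definition zsum f : W := \sum_(i \in [set: int]) f i.

(** A sum with infinite support is 0 by default, so additivity of [zsum] depends on this condition.
    An interval, rather than a finite set, lets [lia] settle support questions. *)
Definition fin_supp f := exists N : int, forall i, f i != 0 -> - N <= i <= N.

(** Joint boundedness in both indices is what the exchange of summations requires; finiteness of
    each row would not suffice. *)
Definition fin_supp2 h :=
  exists N : int, forall i k, h i k != 0 -> (- N <= i <= N) && (- N <= k <= N).

Definition zbox (N : int) : {fset int} :=
  seq_fset tt [seq (k%:Z - `|N|) | k <- iota 0 (absz N).*2.+1].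

Lemma in_zbox N i : i \notin zbox N -> ~~ (- N <= i <= N).
Proof.
apply: contra => bi; rewrite seq_fsetE; apply/mapP.
by exists (absz (i + `|N|)); [rewrite mem_iota; lia | lia].
Qed.

Lemma zsumE N f : (forall i, f i != 0 -> - N <= i <= N) ->
  zsum f = \sum_(i <- zbox N) f i.
Proof.
move=> fN; rewrite /zsum (fsbigTE (zbox N)) // => i /in_zbox.
by apply: contraNeq => /fN.
Qed.

Lemma eq_zsum f g : f =1 g -> zsum f = zsum g.
Proof. by move=> fg; apply: eq_fsbigr => i _. Qed.

Lemma zsum_neq0 f : zsum f != 0 -> exists i, f i != 0.
Proof.
apply: contra_neqP => /forallNP nf; apply: fsbig1 => i _.
by apply/eqP/negPn/negP/nf.
Qed.

Lemma zsum_reindex (u v : int -> int) f : cancel u v -> cancel v u ->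
  zsum f = zsum (fun i => f (u i)).
Proof. by move=> uK vK; apply: reindex_fsbigT; exists v. Qed.

Lemma zsum_shift (c : int) f : zsum f = zsum (fun i => f (i + c)).
Proof. by apply: (@zsum_reindex _ (fun i => i - c)) => i; rewrite ?addrK ?subrK. Qed.

Lemma zsum1 (d : int) f : (forall i, i != d -> f i = 0) -> zsum f = f d.
Proof.
move=> fd; rewrite /zsum (fsbigTE [fset d]%fset) ?big_seq_fset1 // => i.
by rewrite inE => /fd.
Qed.

Lemma zsumB f g : fin_supp f -> fin_supp g ->
  zsum (fun i => f i - g i) = zsum f - zsum g.
Proof.
move=> [M fM] [N gN].
rewrite (@zsumE (`|M| + `|N|) f) => [|i /fM]; last by lia.
rewrite (@zsumE (`|M| + `|N|) g) => [|i /gN]; last by lia.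
rewrite (@zsumE (`|M| + `|N|)) ?sumrB // => i.
have [/eqP f0|/fM ? _] := boolP (f i == 0); last by lia.
by rewrite f0 sub0r oppr_eq0 => /gN; lia.
Qed.

Lemma fin_suppB f g : fin_supp f -> fin_supp g -> fin_supp (fun i => f i - g i).
Proof.
move=> [M fM] [N gN]; exists (`|M| + `|N|) => i.
have [/eqP f0|/fM ? _] := boolP (f i == 0); last by lia.
by rewrite f0 sub0r oppr_eq0 => /gN; lia.
Qed.

Lemma fin_supp2_row h i : fin_supp2 h -> fin_supp (h i).
Proof. by move=> [N hN]; exists N => k /hN/andP[]. Qed.

Lemma zsum_exchange h : fin_supp2 h ->
  zsum (fun i => zsum (h i)) = zsum (fun k => zsum (h ^~ k)).
Proof.
move=> [N hN].
rewrite (@zsumE N) => [|i]; last first.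
  apply: contraR => Ni; rewrite /zsum fsbig1 // => k _.
  by apply: contraNeq Ni => /hN/andP[].
rewrite (@zsumE N _) => [|k]; last first.
  apply: contraR => Ni; rewrite /zsum fsbig1 // => i _.
  by apply: contraNeq Ni => /hN/andP[].
under eq_bigr => i _ do rewrite (@zsumE N) => [|k /hN/andP[]//].
rewrite exchange_big; apply: eq_bigr => k _.
by rewrite (@zsumE N) // => i /hN/andP[].
Qed.

Lemma fin_supp_zsum h : fin_supp2 h -> fin_supp (fun i => zsum (h i)).
Proof.
move=> [N hN]; exists N => i; apply: contraR => Ni; rewrite /zsum fsbig1 // => k _.
by apply: contraNeq Ni => /hN/andP[].
Qed.

Lemma fin_supp2B h h' : fin_supp2 h -> fin_supp2 h' ->
  fin_supp2 (fun i k => h i k - h' i k).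
Proof.
move=> [M hM] [N hN]; exists (`|M| + `|N|) => i k.
have [/eqP f0|/hM ? _] := boolP (h i k == 0); last by lia.
by rewrite f0 sub0r oppr_eq0 => /hN; lia.
Qed.

Lemma zsum2B h h' : fin_supp2 h -> fin_supp2 h' ->
  zsum (fun i => zsum (fun k => h i k - h' i k)) =
  zsum (fun i => zsum (h i)) - zsum (fun i => zsum (h' i)).
Proof.
move=> hF hF'; rewrite -zsumB; try exact: fin_supp_zsum.
by apply: eq_zsum => i; rewrite zsumB //; apply: fin_supp2_row.
Qed.

End IntegerSums.

(** Additivity is asked as compatibility with subtraction, the form in which it is proved for [br1]
    and [vpair]. *)
Lemma zsum_raddf (U W : zmodType) (phi : U -> W) f :
  {morph phi : x y / x - y} -> fin_supp f ->
  phi (zsum f) = zsum (fun i => phi (f i)).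
Proof.
move=> phiB [N fN].
have phi0 : phi 0 = 0 by rewrite -(subrr 0) phiB subrr.
have phiD x y : phi (x + y) = phi x + phi y.
  by rewrite -{1}[y]opprK phiB -(sub0r y) phiB phi0 sub0r opprK.
rewrite (zsumE fN) (big_morph phi phiD phi0) (@zsumE _ N) // => i.
by move=> h; apply: fN; apply: contraNneq h => ->; rewrite phi0.
Qed.

(** * Shifts and brackets *)

Section Shifts.
Variables (F : fieldType) (V : mPVA F).
Implicit Types x y : V.

Lemma shz0 x : shz 0 x = x. Proof. by []. Qed.

Lemma shzS (n : int) x : shz (n + 1) x = shift (shz n x).
Proof.
case: n => [n|[|n]].
- by rewrite (_ : Posz n + 1 = Posz n.+1) //; lia.
- by rewrite /shz /= unshiftK.
by rewrite (_ : Negz n.+1 + 1 = Negz n) /shz /= ?unshiftK //; lia.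
Qed.

Lemma shift_inj : injective (@shift F V).
Proof. exact: (can_inj (@shiftK F V)). Qed.

(** The downward step goes from n + 1 to n, so that an identity at n can be obtained by applying the
    injective [shift] to both sides. *)
Lemma shz_ind (P : int -> Prop) : P 0 -> (forall n : int, P n -> P (n + 1)) ->
  (forall n : int, P (n + 1) -> P n) -> forall n : int, P n.
Proof.
move=> P0 Pu Pd; elim/int_rect => // n Pn.
  by rewrite intS addrC; apply: Pu.
by apply: Pd; rewrite intS opprD addrAC addNr add0r.
Qed.

Lemma shzD (m n : int) x : shz (m + n) x = shz m (shz n x).
Proof.
move: m; apply: shz_ind => [|m IH|m IH]; first by rewrite add0r.
  by rewrite addrAC !shzS IH.
by apply: shift_inj; rewrite -!shzS -IH; congr (shz _ x); lia.
Qed.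

Lemma shz_linear (n : int) : linear (@shz F V n).
Proof.
move: n; apply: shz_ind => [|n IH|n IH] c x y //.
  by rewrite !shzS IH linearP.
by apply: shift_inj; rewrite -shzS IH !shzS -linearP.
Qed.

Lemma shz_monoid (n : int) : monoid_morphism (@shz F V n).
Proof.
move: n; apply: shz_ind => [|n [IH1 IH]|n [IH1 IH]] //; split => [|x y].
- by rewrite shzS IH1 rmorph1.
- by rewrite !shzS IH rmorphM.
- by apply: shift_inj; rewrite -shzS IH1 rmorph1.
by apply: shift_inj; rewrite -shzS IH !shzS -rmorphM.
Qed.

HB.instance Definition _ n := GRing.isLinear.Build F V V _ (@shz F V n) (shz_linear n).
HB.instance Definition _ n := GRing.isMonoidMorphism.Build V V (@shz F V n) (shz_monoid n).

End Shifts.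

(** * Derivation properties of {\int a, .} and the Leibniz rule in the first argument *)

Section Bracket.
Variables (F : fieldType) (V : mPVA F).
Implicit Types a b c d : V.

Lemma br_supp a b : fin_supp (br a b).
Proof.
have /finite_fsetP[r Er] := br_finite a b.
exists (\sum_(i <- r) `|i|) => n n0.
have: n \in r by have: [set n | br a b n != 0] n by []; rewrite Er.
move=> nr; rewrite -lter_norml (big_fsetD1 n) //= lerDl.
by apply: sumr_ge0.
Qed.

(** Skew-symmetry turns this into the Leibniz rule in the second argument; its twist by S^n ends up
    on the factor that is not bracketed. *)
Lemma br_leibnizl a b c (n : int) :
  br (a * b) c n = br a c n * shz n b + br b c n * shz n a.
Proof.
rewrite br_skew (br_skew c a) (br_skew c b) br_leibniz.
by rewrite -/(shz n _) rmorphD !rmorphM /= opprD !mulNr.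
Qed.

Lemma br_shzr a b (m n : int) : br a (shz m b) n = shz m (br a b (n - m)).
Proof.
move: m n; apply: shz_ind => [|m IH|m IH] n; first by rewrite subr0.
  by rewrite shzS br_shiftr IH -shzS; do 2 f_equal; lia.
apply: shift_inj; rewrite -[in LHS](addrK 1 n) -br_shiftr -shzS IH -shzS.
by do 2 f_equal; lia.
Qed.

Lemma br_shzl a b (m n : int) : br (shz m a) b n = br a b (n + m).
Proof.
move: m n; apply: shz_ind => [|m IH|m IH] n; first by rewrite addr0.
  by rewrite shzS br_shiftl IH; congr (br a b _); lia.
by rewrite -[in LHS](subrK 1 n) -br_shiftl -shzS IH; congr (br a b _); lia.
Qed.

Lemma mulr_neq0l x y : x * y != 0 -> x != 0 :> V.
Proof. by apply: contraNneq => ->; rewrite mul0r. Qed.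

Lemma mulr_neq0r x y : x * y != 0 -> y != 0 :> V.
Proof. by apply: contraNneq => ->; rewrite mulr0. Qed.

Lemma shz_neq0 n x : shz n x != 0 -> x != 0 :> V.
Proof. by apply: contraNneq => ->; rewrite rmorph0. Qed.

Lemma br10 b : br1 0 b = 0.
Proof. by rewrite -{1}(subrr (0 : V)) br1_Bl subrr. Qed.

Lemma br1_shzr h m b : br1 h (shz m b) = shz m (br1 h b).
Proof.
rewrite /br1 -!/(zsum _) (zsum_raddf (rmorphB _)); last exact: br_supp.
by rewrite (zsum_shift m); apply: eq_zsum => n; rewrite br_shzr addrK.
Qed.

Lemma br1_mulr h a b : br1 h (a * b) = br1 h a * b + br1 h b * a.
Proof.
have mulB c : {morph *%R^~ c : x y / x - y :> V} by move=> x y; rewrite mulrBl.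
suff -> : br1 h a * b = br1 h (a * b) - br1 h b * a by rewrite subrK.
rewrite /br1 -!/(zsum _) !(zsum_raddf (mulB _)); try exact: br_supp.
rewrite -zsumB; [by apply: eq_zsum => n; rewrite br_leibniz addrK|exact: br_supp|].
by have [N hN] := br_supp h b; exists N => n /mulr_neq0l; exact: hN.
Qed.

Lemma br1_sum h (f : int -> V) : fin_supp f -> br1 h (zsum f) = zsum (fun i => br1 h (f i)).
Proof. exact: (zsum_raddf (br1_Br h)). Qed.

(* The part of {\int a b, c} in which the bracket falls on the factor a. *)
Definition vpair c a b : V := zsum (fun k => br a c k * shz k b).

Lemma vpair_fin c a b : fin_supp (fun k => br a c k * shz k b).
Proof. by have [N hN] := br_supp a c; exists N => k /mulr_neq0l/hN. Qed.

Lemma vpairBl c b : {morph (fun a => vpair c a b) : x y / x - y}.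
Proof.
move=> x y; rewrite /= /vpair -zsumB; try exact: vpair_fin.
by apply: eq_zsum => k; rewrite br_Bl mulrBl.
Qed.

Lemma vpairBr c a : {morph vpair c a : x y / x - y}.
Proof.
move=> x y; rewrite /= /vpair -zsumB; try exact: vpair_fin.
by apply: eq_zsum => k; rewrite rmorphB mulrBr.
Qed.

Lemma vpair_neq0l c a b : vpair c a b != 0 -> a != 0.
Proof. by apply: contraNneq => ->; rewrite -{1}(subrr (0 : V)) vpairBl subrr. Qed.

Lemma vpair_neq0r c a b : vpair c a b != 0 -> b != 0.
Proof. by apply: contraNneq => ->; rewrite -{1}(subrr (0 : V)) vpairBr subrr. Qed.

(** Invariance of {\int ab, c} under S: the power of lambda gained by shifting a is absorbed by the
    sum over k. *)
Lemma vpair_shz c m a b : vpair c (shz m a) (shz m b) = vpair c a b.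
Proof.
rewrite /vpair (zsum_shift (- m)); apply: eq_zsum => k.
by rewrite br_shzl -shzD !subrK.
Qed.

(** In the product abd, a bracket falling on ab falls either on a or on b. *)
Lemma vpairM c a b d : vpair c a (b * d) = vpair c (a * b) d - vpair c b (a * d).
Proof.
rewrite /vpair -zsumB; try exact: vpair_fin.
by apply: eq_zsum => k; rewrite br_leibnizl !rmorphM /=; ring.
Qed.

Lemma vpair1 c a : vpair c a 1 = br1 a c.
Proof. by apply: eq_zsum => k; rewrite rmorph1 mulr1. Qed.

End Bracket.

(** * Pseudodifference operators *)

Section SidedOperators.
Variables (F : fieldType) (V : mPVA F) (s : bool).
Implicit Types A B C : pdop V.

(* [s] selects V((S^-1)) ([true]) or V((S)) ([false]). *)
Definition sided A :=
  exists N : int, forall n, A n != 0 -> (if s then n else - n) <= N.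

Lemma pmulE A B n : pmul A B n = zsum (fun i => A i * shz i (B (n - i))).
Proof. by []. Qed.

Lemma pmul_fin A B n : sided A -> sided B ->
  fin_supp (fun i => A i * shz i (B (n - i))).
Proof.
move=> [a hA] [b hB]; exists (`|a| + `|b| + `|n|) => i h.
by have := hA _ (mulr_neq0l h); have := hB _ (shz_neq0 (mulr_neq0r h)); case: s; lia.
Qed.

Lemma sided_mul A B : sided A -> sided B -> sided (pmul A B).
Proof.
move=> [a hA] [b hB]; exists (a + b) => n /zsum_neq0[i h].
by have := hA _ (mulr_neq0l h); have := hB _ (shz_neq0 (mulr_neq0r h)); case: s; lia.
Qed.

Lemma sided_pone : sided (pone V).
Proof.
by exists 0 => n; rewrite /pone; have [->|_] := eqVneq n 0; [case: s|rewrite eqxx].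
Qed.

Lemma sided_exp A n : sided A -> sided (pexp A n).
Proof. by move=> hA; elim: n => [|n IH]; [exact: sided_pone | exact: sided_mul]. Qed.

Lemma sided_ppos A : sided A -> sided (ppos A).
Proof.
move=> [a hA]; exists a => n; rewrite /ppos.
by case: ifP; rewrite ?eqxx // => _ /hA.
Qed.

Lemma pmul1 A : pmul A (pone V) = A.
Proof.
apply/funext => n; rewrite pmulE (@zsum1 _ n) => [|i].
  by rewrite /pone subrr eqxx rmorph1 mulr1.
by rewrite /pone subr_eq0 eq_sym => /negPf->; rewrite rmorph0 mulr0.
Qed.

Lemma p1mul A : pmul (pone V) A = A.
Proof.
apply/funext => n; rewrite pmulE (@zsum1 _ 0) => [|i].
  by rewrite /pone eqxx mul1r subr0.
by rewrite /pone => /negPf->; rewrite mul0r.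
Qed.

Lemma pmulA A B C : sided A -> sided B -> sided C ->
  pmul (pmul A B) C = pmul A (pmul B C).
Proof.
move=> hA hB hC; apply/funext => n; rewrite !pmulE.
pose h (k i : int) := A i * shz i (B (k - i)) * shz k (C (n - k)).
(* The indices of A, B and C add up to n and are bounded on the same side, hence on both sides. *)
have hF : fin_supp2 h.
  case: hA hB hC => [a hA] [b hB] [c hC]; exists (`|a| + `|b| + `|c| + `|n|) => k i hn.
  have := hC _ (shz_neq0 (mulr_neq0r hn)); have := hA _ (mulr_neq0l (mulr_neq0l hn)).
  by have := hB _ (shz_neq0 (mulr_neq0r (mulr_neq0l hn))); case: s; lia.
transitivity (zsum (fun k => zsum (h k))).
  apply: eq_zsum => k; rewrite pmulE (zsum_raddf (phi := *%R^~ _)) //.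
    by move=> x y /=; rewrite mulrBl.
  exact: pmul_fin.
rewrite zsum_exchange //; apply: eq_zsum => i.
rewrite pmulE (zsum_raddf (rmorphB _)); last exact: pmul_fin.
rewrite (zsum_raddf (mulrBr _)); last first.
  have [N hN] := pmul_fin (n - i) hB hC.
  by exists N => m /shz_neq0/hN.
rewrite (zsum_shift i); apply: eq_zsum => m; rewrite /h rmorphM /= -shzD mulrA.
by rewrite addrK; congr (_ * shz _ (C _)); lia.
Qed.

Lemma pexpC A n : sided A -> pmul (pexp A n) A = pmul A (pexp A n).
Proof.
move=> hA; elim: n => [|n IH]; first by rewrite pmul1 p1mul.
by rewrite /= -/(pexp A n) pmulA ?IH //; exact: sided_exp.
Qed.

(* The part of {\int mRes (A B), c} in which the bracket falls on the
   coefficients of A. *)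
Definition vres c A B : V := zsum (fun i => vpair c (A i) (shz i (B (- i)))).

(* Coefficientwise, the Leibniz rule for {\int mRes (A B C), c} together with
   the cyclicity of \int mRes. *)
Lemma vresM c A B C : sided A -> sided B -> sided C ->
  vres c A (pmul B C) = vres c (pmul A B) C - vres c B (pmul C A).
Proof.
move=> hA hB hC.
have [[[a ha] [b hb]] [d hd]] := (hA, hB, hC); pose N := `|a| + `|b| + `|d|.
pose h (n i : int) := vpair c (A i * shz i (B (n - i))) (shz n (C (- n))).
pose h' (n i : int) := vpair c (shz i (B (n - i))) (A i * shz n (C (- n))).
have hF : fin_supp2 h.
  exists N => n i hn; have := ha _ (mulr_neq0l (vpair_neq0l hn)).
  have := hb _ (shz_neq0 (mulr_neq0r (vpair_neq0l hn))).
  by have := hd _ (shz_neq0 (vpair_neq0r hn)); rewrite /N; case: s; lia.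
have hF' : fin_supp2 h'.
  exists N => n i hn; have := ha _ (mulr_neq0l (vpair_neq0r hn)).
  have := hb _ (shz_neq0 (vpair_neq0l hn)).
  by have := hd _ (shz_neq0 (mulr_neq0r (vpair_neq0r hn))); rewrite /N; case: s; lia.
have -> : vres c (pmul A B) C = zsum (fun n => zsum (h n)).
  apply: eq_zsum => n; rewrite pmulE.
  by rewrite (zsum_raddf (vpairBl c _)); last exact: pmul_fin.
have -> : vres c B (pmul C A) = zsum (fun n => zsum (h' n)).
  (* Here i is the index of A and j that of B, once the product C A has been expanded and its
     summation index replaced by - j - i. *)
  pose g (j i : int) := vpair c (B j) (shz (- i) (A i) * shz j (C (- (j + i)))).
  have gF : fin_supp2 g.
    exists N => j i hn; have := ha _ (shz_neq0 (mulr_neq0l (vpair_neq0r hn))).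
    have := hb _ (vpair_neq0l hn).
    by have := hd _ (shz_neq0 (mulr_neq0r (vpair_neq0r hn))); rewrite /N; case: s; lia.
  rewrite zsum_exchange //; transitivity (zsum (fun i => zsum (g ^~ i))).
    rewrite -zsum_exchange //; apply: eq_zsum => j; rewrite pmulE.
    rewrite (zsum_raddf (rmorphB _)); last exact: pmul_fin.
    rewrite (zsum_raddf (vpairBr c _)); last first.
      have [M hM] := pmul_fin (- j) hC hA.
      by exists M => m /shz_neq0/hM.
    rewrite (@zsum_reindex _ (fun i => - j - i) (fun i => - j - i)); try by move=> i; lia.
    apply: eq_zsum => i; rewrite rmorphM /= -shzD mulrC.
    have -> : j + (- j - i) = - i by lia.
    have -> : - j - (- j - i) = i by lia.
    by rewrite /g opprD.
  (* This is the cyclicity: with n = j + i, applying S^i to both entries of [g] gives [h'], and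
     [vpair] does not change. *)
  apply: eq_zsum => i; rewrite [RHS](zsum_shift i); apply: eq_zsum => j.
  rewrite /g /h' addrK -(vpair_shz c i) rmorphM /= -!shzD addrN shz0.
  by rewrite [i + j]addrC.
rewrite -zsum2B // zsum_exchange; last exact: fin_supp2B.
apply: eq_zsum => i; rewrite pmulE.
rewrite (zsum_raddf (rmorphB _)); last exact: pmul_fin.
rewrite (zsum_raddf (vpairBr c _)); last first.
  have [M hM] := pmul_fin (- i) hB hC.
  by exists M => m /shz_neq0/hM.
rewrite (zsum_shift (- i)); apply: eq_zsum => n.
rewrite /h /h' -vpairM rmorphM /= -shzD.
have -> : i + (n - i) = n by lia.
by have -> : - i - (n - i) = - n by lia.
Qed.

Lemma vres1 c A : vres c A (pone V) = br1 (mRes A) c.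
Proof.
rewrite /vres (@zsum1 _ 0) => [|i i0]; first by rewrite /pone oppr0 eqxx vpair1.
apply/eqP; apply: contraNT i0 => /vpair_neq0r/shz_neq0.
by rewrite /pone oppr_eq0; case: (i == 0); rewrite ?eqxx.
Qed.

(** By [vresM], one factor A of A^(m+2) is split off and the rest is paired with B A. As B commutes
    with A, each of the factors contributes the same amount. The induction is over all such B
    because B is replaced by B A. *)
Lemma vres_exp c A m B : sided A -> sided B -> pmul A B = pmul B A ->
  vres c (pexp A m.+1) B = (vres c A (pmul (pexp A m) B)) *+ m.+1.
Proof.
move=> hA hB AB; elim: m B hB AB => [|m IH] B hB AB; first by rewrite /= pmul1 p1mul.
have hE := sided_exp m hA; have hE' := sided_exp m.+1 hA.
rewrite [LHS](_ : _ = vres c A (pmul (pexp A m.+1) B) + vres c (pexp A m.+1) (pmul B A)).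
  rewrite IH; [|exact: sided_mul|by rewrite -pmulA // AB].
  by rewrite -AB -pmulA // pexpC // -mulrS.
by rewrite vresM //= subrK.
Qed.

Lemma br1_mRes_exp c A m : sided A ->
  br1 (mRes (pexp A m.+1)) c = vres c A (pexp A m) *+ m.+1.
Proof.
move=> hA; rewrite -vres1 vres_exp ?pmul1 ?p1mul //; exact: sided_pone.
Qed.

End SidedOperators.

(** * Coefficients of the Adler identities *)

Section AdlerCoefficients.
Variables (F : fieldType) (V : mPVA F).
Implicit Types (A B : dist V) (a L : pdop V) (i j l s : int).

Lemma mono_mulz (i j l s n : int) :
  ((i, j, l, s) : mono) *~ n = (i * n, j * n, l * n, s * n).
Proof.
rewrite -!mulrzz; set x := (i, j, l, s).
rewrite [LHS]surjective_pairing [(_ *~ n).1]surjective_pairing.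
by rewrite [_.1.1]surjective_pairing !raddfMz.
Qed.

(** Every support condition below is kept as a boolean guard in linear integer arithmetic, which
    [lia] decides. *)
Definition when (W : zmodType) (c : bool) (x : W) : W := if c then x else 0.

(** The powers of a nontrivial monomial are distinct, so an exponent is reached at most once: at d
    if c holds, never otherwise. *)
Lemma substE a (i j l s x1 x2 x3 x4 : int) (c : bool) (d : int) :
    (forall n, c && (n == d) =
       [&& x1 * n == i, x2 * n == j, x3 * n == l & x4 * n == s]) ->
  subst a ((x1, x2, x3, x4) : mono) (i, j, l, s) = when c (a d).
Proof.
move=> xe; rewrite /subst /when.
have nE n : ((x1, x2, x3, x4) : mono) *~ n = (i, j, l, s) <-> c && (n == d).
  rewrite mono_mulz xe; split=> [[<- <- <- <-]|]; first by rewrite !eqxx.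
  by case/and4P => /eqP-> /eqP-> /eqP-> /eqP->.
case: c nE {xe} => nE.
  rewrite (_ : [set _ | _] = [set d]) ?fsbig_set1 //.
  by apply/seteqP; split => n /= => [/nE/eqP|->] //; apply/nE/eqP.
rewrite (_ : [set _ | _] = set0) ?fsbig_set0 //.
by apply/seteqP; split => n //= /nE.
Qed.

(* In lemma names z, w, l, S, ... spell monomials: wlS is w lambda S, wlSz is
   w lambda S / z, lz is lambda / z, and so on. *)
Lemma subst_wlS a i j l s : subst a (mw + ml + mS) (i, j, l, s) =
  when ((i == 0) && (j == l) && (l == s)) (a j).
Proof. by apply: (@substE _ _ _ _ _ 0 1 1 1) => n; lia. Qed.

Lemma subst_wlSz a i j l s : subst a (mw + ml + mS - mz) (i, j, l, s) =
  when ((j == l) && (l == s) && (i == - j)) (a j).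
Proof. by apply: (@substE _ _ _ _ _ (-1) 1 1 1) => n; lia. Qed.

Lemma subst_lz a i j l s : subst a (ml - mz) (i, j, l, s) =
  when ((j == 0) && (s == 0) && (i == - l)) (a l).
Proof. by apply: (@substE _ _ _ _ _ (-1) 0 1 0) => n; lia. Qed.

Lemma subst_z a i j l s : subst a mz (i, j, l, s) =
  when ((j == 0) && (l == 0) && (s == 0)) (a i).
Proof. by apply: (@substE _ _ _ _ _ 1 0 0 0) => n; lia. Qed.

Lemma subst_w a i j l s : subst a mw (i, j, l, s) =
  when ((i == 0) && (l == 0) && (s == 0)) (a j).
Proof. by apply: (@substE _ _ _ _ _ 0 1 0 0) => n; lia. Qed.

Lemma subst_wlz a i j l s : subst a (mw + ml - mz) (i, j, l, s) =
  when ((s == 0) && (j == l) && (i == - l)) (a l).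
Proof. by apply: (@substE _ _ _ _ _ (-1) 1 1 0) => n; lia. Qed.

Lemma subst_wl a i j l s : subst a (mw + ml) (i, j, l, s) =
  when ((i == 0) && (s == 0) && (j == l)) (a l).
Proof. by apply: (@substE _ _ _ _ _ 0 1 1 0) => n; lia. Qed.

Lemma delta_wlSz i j l s : subst (delta_plus V) (mw + ml + mS - mz) (i, j, l, s) =
  when [&& j == l, l == s, i == - j & 0 <= j] 1.
Proof.
rewrite subst_wlSz /when /delta_plus -!andbA.
by do !case: eqP => //= _; case: ifP.
Qed.

Lemma delta_wlz i j l s : subst (delta_plus V) (mw + ml - mz) (i, j, l, s) =
  when [&& s == 0, j == l, i == - l & 0 <= l] 1.
Proof.
rewrite subst_wlz /when /delta_plus -!andbA.
by do !case: eqP => //= _; case: ifP.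
Qed.

Lemma dmono_wlSz i j l s : dmono V (mw + ml + mS - mz) (i, j, l, s) =
  when [&& i == -1, j == 1, l == 1 & s == 1] 1.
Proof.
rewrite /dmono /when -pair_eqE /= /pair_eq /= -!pair_eqE /= /pair_eq /=.
by rewrite -!andbA; case: ifP => _.
Qed.

Lemma dmono_wlz i j l s : dmono V (mw + ml - mz) (i, j, l, s) =
  when [&& i == -1, j == 1, l == 1 & s == 0] 1.
Proof.
rewrite /dmono /when -pair_eqE /= /pair_eq /= -!pair_eqE /= /pair_eq /=.
by rewrite -!andbA; case: ifP => _.
Qed.

(** Finiteness is local to one exponent e. It is what distributivity needs, since [dmul] takes the
    default value 0 on infinite sums. *)
Definition dmul_fin A B (e : mono) :=
  exists r : {fset mono}, forall d, d \notin r -> A d * shz d.2 (B (e - d)) = 0.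

Lemma dmulDl A A' B e : dmul_fin A B e -> dmul_fin A' B e ->
  dmul (A \+ A') B e = dmul A B e + dmul A' B e.
Proof.
move=> [r hr] [r' hr']; rewrite /dmul !(fsbigTE (r `|` r')%fset).
- by rewrite -big_split; apply: eq_bigr => d _; rewrite /= mulrDl.
- by move=> d; rewrite inE negb_or => /andP[_ /hr'].
- by move=> d; rewrite inE negb_or => /andP[/hr].
- by move=> d; rewrite inE negb_or /= mulrDl => /andP[/hr-> /hr'->]; rewrite addr0.
Qed.

Lemma dmulBl A A' B e : dmul_fin A B e -> dmul_fin A' B e ->
  dmul (A \- A') B e = dmul A B e - dmul A' B e.
Proof.
move=> [r hr] [r' hr']; rewrite /dmul !(fsbigTE (r `|` r')%fset).
- by rewrite -sumrB; apply: eq_bigr => d _; rewrite /= mulrBl.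
- by move=> d; rewrite inE negb_or => /andP[_ /hr'].
- by move=> d; rewrite inE negb_or => /andP[/hr].
- by move=> d; rewrite inE negb_or /= mulrBl => /andP[/hr-> /hr'->]; rewrite subr0.
Qed.

Lemma dmulBr A B B' e : dmul_fin A B e -> dmul_fin A B' e ->
  dmul A (B \- B') e = dmul A B e - dmul A B' e.
Proof.
move=> [r hr] [r' hr']; rewrite /dmul !(fsbigTE (r `|` r')%fset).
- by rewrite -sumrB; apply: eq_bigr => d _; rewrite /= rmorphB mulrBr.
- by move=> d; rewrite inE negb_or => /andP[_ /hr'].
- by move=> d; rewrite inE negb_or => /andP[/hr].
- by move=> d; rewrite inE negb_or /= rmorphB mulrBr => /andP[/hr-> /hr'->]; rewrite subr0.
Qed.

Lemma dmul_finDl A A' B e : dmul_fin A B e -> dmul_fin A' B e -> dmul_fin (A \+ A') B e.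
Proof.
move=> [r hr] [r' hr']; exists (r `|` r')%fset => d.
by rewrite inE negb_or /= mulrDl => /andP[/hr-> /hr'->]; rewrite addr0.
Qed.

(* The factors (d, e - d) of the exponent e contribute only when d = d0. *)
Definition dmul_at A B (i j l s d1 d2 d3 d4 : int) := forall k1 k2 k3 k4 : int,
  A (k1, k2, k3, k4) != 0 -> B (i - k1, j - k2, l - k3, s - k4) != 0 ->
  [&& k1 == d1, k2 == d2, k3 == d3 & k4 == d4].

Lemma dmul_at0 A B i j l s d1 d2 d3 d4 (d : mono) :
  dmul_at A B i j l s d1 d2 d3 d4 -> d != (d1, d2, d3, d4) ->
  A d * shz d.2 (B (((i, j, l, s) : mono) - d)) = 0.
Proof.
case: d => [[[k1 k2] k3] k4] h; apply: contraNeq => n0.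
have := h k1 k2 k3 k4 (mulr_neq0l n0) (shz_neq0 (mulr_neq0r n0)).
by case/and4P=> /eqP-> /eqP-> /eqP-> /eqP->.
Qed.

Lemma dmul_at_fin A B i j l s d1 d2 d3 d4 :
  dmul_at A B i j l s d1 d2 d3 d4 -> dmul_fin A B (i, j, l, s).
Proof.
move=> h; exists [fset ((d1, d2, d3, d4) : mono)]%fset => d; rewrite inE.
exact: dmul_at0 h.
Qed.

Lemma dmul_atE A B i j l s d1 d2 d3 d4 : dmul_at A B i j l s d1 d2 d3 d4 ->
  dmul A B (i, j, l, s) =
  A (d1, d2, d3, d4) * shz d4 (B (i - d1, j - d2, l - d3, s - d4)).
Proof.
move=> h; rewrite /dmul (fsbigTE [fset ((d1, d2, d3, d4) : mono)]%fset).
  by rewrite big_seq_fset1.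
move=> d.
by rewrite inE; exact: dmul_at0 h.
Qed.

Lemma when_neq0 (c : bool) (x : V) : when c x != 0 -> c.
Proof. by case: c => //; rewrite eqxx. Qed.

Lemma mul_when c c1 c2 (x y z : V) n : c = c1 && c2 -> (c -> z = x * shz n y) ->
  when c1 x * shz n (when c2 y) = when c z.
Proof.
move=> ->; rewrite /when; case: c1 => /=; last by rewrite mul0r.
by case: c2 => /= [->|]; rewrite ?rmorph0 ?mulr0.
Qed.

(** The scheme for all products below: the exponent factors in at most one contributing way, so a
    product of guarded coefficients is again a guarded coefficient. *)
Lemma dmul_when A B i j l s d1 d2 d3 d4 c1 c2 c (x y z : V) :
  dmul_at A B i j l s d1 d2 d3 d4 ->
  A (d1, d2, d3, d4) = when c1 x ->
  B (i - d1, j - d2, l - d3, s - d4) = when c2 y ->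
  c = c1 && c2 -> (c -> z = x * shz d4 y) ->
  dmul_fin A B (i, j, l, s) /\ dmul A B (i, j, l, s) = when c z.
Proof.
move=> h xE yE cE zE; split; first exact: dmul_at_fin h.
by rewrite (dmul_atE h) xE yE; apply: mul_when.
Qed.

(** * Coefficients of the right-hand side of the 2-Adler identity *)

Variable L : pdop V.

Local Notation "A ** B" := (dmul A B) (at level 40, left associativity).
Local Notation delta := (subst (delta_plus V)).

Lemma LwlS_delta i j l s :
  (subst L (mw + ml + mS) ** delta (mw + ml + mS - mz)) (i, j, l, s) =
  when [&& j == l, l == s & i <= 0] (L (i + j)).
Proof.
(* Only delta_+ carries z, so its summation index is - i, which leaves i + j for L. *)
refine (proj2 (dmul_when (d1 := 0) (d2 := i + j) (d3 := i + j) (d4 := i + j) _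
          (subst_wlS _ _ _ _ _) (delta_wlSz _ _ _ _) _ _)).
- by move=> k1 k2 k3 k4; rewrite subst_wlS delta_wlSz => /when_neq0 h /when_neq0; lia.
- by lia.
- by move=> _; rewrite rmorph1 mulr1.
Qed.

(** The summation index of delta_+ is j - i - l, and its nonnegativity is the cut-off l <= j - i. *)
Lemma LwlS_delta_adj i j l s :
  (subst L (mw + ml + mS) ** delta (mw + ml + mS - mz) ** subst (padj L) (ml - mz))
    (i, j, l, s) =
  when ((s == j) && (l <= j - i)) (L (i + l) * shz l (L (j - l))).
Proof.
refine (proj2 (dmul_when (d1 := i + l - s) (d2 := s) (d3 := s) (d4 := s) _
          (LwlS_delta _ _ _ _) (subst_lz _ _ _ _ _) _ _)).
- by move=> k1 k2 k3 k4; rewrite LwlS_delta subst_lz => /when_neq0 h /when_neq0; lia.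
- by lia.
- case/andP=> /eqP-> _; rewrite /padj -shzD.
  have -> : i + l - j + j = i + l by lia.
  have -> : j + (l - j) = l by lia.
  by have -> : - (l - j) = j - l by lia.
Qed.

Lemma Lz_delta i j l s :
  (subst L mz ** delta (mw + ml + mS - mz)) (i, j, l, s) =
  when [&& j == l, l == s & 0 <= l] (L (i + l)).
Proof.
refine (proj2 (dmul_when (d1 := i + l) (d2 := 0) (d3 := 0) (d4 := 0) _
          (subst_z _ _ _ _ _) (delta_wlSz _ _ _ _) _ _)).
- by move=> k1 k2 k3 k4; rewrite subst_z delta_wlSz => /when_neq0 h /when_neq0; lia.
- by lia.
- by move=> _; rewrite mulr1.
Qed.

(** Now the summation index of delta_+ is l. The coefficient is the same as in [LwlS_delta_adj];
    only the cut-off differs. *)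
Lemma Lz_delta_Lw i j l s :
  (subst L mz ** delta (mw + ml + mS - mz) ** subst L mw) (i, j, l, s) =
  when ((s == l) && (0 <= l)) (L (i + l) * shz l (L (j - l))).
Proof.
refine (proj2 (dmul_when (d1 := i) (d2 := l) (d3 := l) (d4 := l) _
          (Lz_delta _ _ _ _) (subst_w _ _ _ _ _) _ _)).
- by move=> k1 k2 k3 k4; rewrite Lz_delta subst_w => /when_neq0 h /when_neq0; lia.
- by lia.
- by [].
Qed.

Lemma LwlS_adj i j l s :
  dmul_fin (subst L (mw + ml + mS)) (subst (padj L) (ml - mz)) (i, j, l, s) /\
  (subst L (mw + ml + mS) ** subst (padj L) (ml - mz)) (i, j, l, s) =
  when ((s == j) && (l == j - i)) (L j * shz l (L i)).
Proof.
refine (dmul_when (d1 := 0) (d2 := j) (d3 := j) (d4 := j) _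
          (subst_wlS _ _ _ _ _) (subst_lz _ _ _ _ _) _ _).
- by move=> k1 k2 k3 k4; rewrite subst_wlS subst_lz => /when_neq0 h /when_neq0; lia.
- by lia.
- case/andP=> _ /eqP->; rewrite /padj -shzD.
  have -> : j + (j - i - j) = j - i by lia.
  by have -> : - (j - i - j) = i by lia.
Qed.

Lemma LwlS_Lz i j l s :
  dmul_fin (subst L (mw + ml + mS)) (subst L mz) (i, j, l, s) /\
  (subst L (mw + ml + mS) ** subst L mz) (i, j, l, s) =
  when ((s == j) && (l == j)) (L j * shz l (L i)).
Proof.
refine (dmul_when (d1 := 0) (d2 := j) (d3 := j) (d4 := j) _
          (subst_wlS _ _ _ _ _) (subst_z _ _ _ _ _) _ _).
- by move=> k1 k2 k3 k4; rewrite subst_wlS subst_z => /when_neq0 h /when_neq0; lia.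
- by lia.
- by case/andP=> _ /eqP->; rewrite subr0.
Qed.

Lemma Lw_adj i j l s :
  dmul_fin (subst L mw) (subst (padj L) (ml - mz)) (i, j, l, s) /\
  (subst L mw ** subst (padj L) (ml - mz)) (i, j, l, s) =
  when ((s == 0) && (l == - i)) (L j * shz l (L i)).
Proof.
refine (dmul_when (d1 := 0) (d2 := j) (d3 := 0) (d4 := 0) _
          (subst_w _ _ _ _ _) (subst_lz _ _ _ _ _) _ _).
- by move=> k1 k2 k3 k4; rewrite subst_w subst_lz => /when_neq0 h /when_neq0; lia.
- by lia.
- by case/andP=> _ /eqP->; rewrite /padj subr0 opprK.
Qed.

Lemma Lw_Lz i j l s :
  dmul_fin (subst L mw) (subst L mz) (i, j, l, s) /\
  (subst L mw ** subst L mz) (i, j, l, s) =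
  when ((s == 0) && (l == 0)) (L j * shz l (L i)).
Proof.
refine (dmul_when (d1 := 0) (d2 := j) (d3 := 0) (d4 := 0) _
          (subst_w _ _ _ _ _) (subst_z _ _ _ _ _) _ _).
- by move=> k1 k2 k3 k4; rewrite subst_w subst_z => /when_neq0 h /when_neq0; lia.
- by lia.
- by case/andP=> _ /eqP->; rewrite subr0.
Qed.

(** The four half terms are grouped as l = e - i against l = e, for e = j and e = 0. Writing [0 - i]
    makes both groups instances of one pattern. *)
Lemma adler2_rhsE i j l s : adler2_rhs L (i, j, l, s) =
  when ((s == j) && (l <= j - i)) (L (i + l) * shz l (L (j - l)))
  - when ((s == l) && (0 <= l)) (L (i + l) * shz l (L (j - l)))
  - (2%:R^-1 : F) *:
    (when ((s == j) && (l == j - i)) (L j * shz l (L i))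
     - when ((s == j) && (l == j)) (L j * shz l (L i))
     - (when ((s == 0) && (l == 0)) (L j * shz l (L i))
        - when ((s == 0) && (l == 0 - i)) (L j * shz l (L i)))).
Proof.
have [f1 e1] := LwlS_adj i j l s; have [f2 e2] := Lw_adj i j l s.
have [f3 e3] := LwlS_Lz i j l s; have [f4 e4] := Lw_Lz i j l s.
rewrite /adler2_rhs /= LwlS_delta_adj Lz_delta_Lw dmulBr; try exact: dmul_finDl.
rewrite !dmulDl // e1 e2 e3 e4 sub0r; congr (_ - _ *: _).
by rewrite opprB opprD addrACA.
Qed.

(** * Coefficients of the right-hand side of the 1-Adler identity *)

Lemma mono_Sadj i j l s :
  (dmono V (mw + ml + mS - mz) ** subst (padj L) (ml - mz)) (i, j, l, s) =
  when [&& j == 1, s == 1 & i == - l] (shz l (L (1 - l))).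
Proof.
refine (proj2 (dmul_when (d1 := -1) (d2 := 1) (d3 := 1) (d4 := 1) _
          (dmono_wlSz _ _ _ _) (subst_lz _ _ _ _ _) _ _)).
- by move=> k1 k2 k3 k4; rewrite dmono_wlSz subst_lz => /when_neq0 h /when_neq0; lia.
- by lia.
- move=> _; rewrite mul1r /padj -shzD.
  have -> : 1 + (l - 1) = l by lia.
  by have -> : - (l - 1) = 1 - l by lia.
Qed.

(** The extra factor w lambda S / z raises the power by one, so the cut-off is 1 <= j instead of 0
    <= j. *)
Lemma delta_mono_Sadj i j l s :
  dmul_fin (delta (mw + ml + mS - mz))
    (dmono V (mw + ml + mS - mz) ** subst (padj L) (ml - mz)) (i, j, l, s) /\
  (delta (mw + ml + mS - mz) **
    (dmono V (mw + ml + mS - mz) ** subst (padj L) (ml - mz))) (i, j, l, s) =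
  when [&& s == j, l == - i & 1 <= j] (shz l (L (i + j))).
Proof.
refine (dmul_when (d1 := 1 - s) (d2 := s - 1) (d3 := s - 1) (d4 := s - 1) _
          (delta_wlSz _ _ _ _) (mono_Sadj _ _ _ _) _ _).
- by move=> k1 k2 k3 k4; rewrite delta_wlSz mono_Sadj => /when_neq0 h /when_neq0; lia.
- by lia.
- case/and3P=> /eqP-> /eqP-> _; rewrite mul1r -shzD.
  have -> : j - 1 + (- i - (j - 1)) = - i by lia.
  by have -> : 1 - (- i - (j - 1)) = i + j by lia.
Qed.

Lemma delta_Lw i j l s :
  dmul_fin (delta (mw + ml + mS - mz)) (subst L mw) (i, j, l, s) /\
  (delta (mw + ml + mS - mz) ** subst L mw) (i, j, l, s) =
  when [&& s == - i, l == - i & i <= 0] (shz l (L (i + j))).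
Proof.
refine (dmul_when (d1 := i) (d2 := - i) (d3 := - i) (d4 := - i) _
          (delta_wlSz _ _ _ _) (subst_w _ _ _ _ _) _ _).
- by move=> k1 k2 k3 k4; rewrite delta_wlSz subst_w => /when_neq0 h /when_neq0; lia.
- by lia.
- by case/and3P=> _ /eqP-> _; rewrite mul1r opprK [j + i]addrC.
Qed.

Lemma Lz_mono i j l s : (subst L mz ** dmono V (mw + ml - mz)) (i, j, l, s) =
  when [&& j == 1, l == 1 & s == 0] (L (i + 1)).
Proof.
refine (proj2 (dmul_when (d1 := i + 1) (d2 := 0) (d3 := 0) (d4 := 0) _
          (subst_z _ _ _ _ _) (dmono_wlz _ _ _ _) _ _)).
- by move=> k1 k2 k3 k4; rewrite subst_z dmono_wlz => /when_neq0 h /when_neq0; lia.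
- by lia.
- by rewrite mulr1.
Qed.

Lemma Lz_mono_delta i j l s :
  dmul_fin (subst L mz ** dmono V (mw + ml - mz)) (delta (mw + ml - mz)) (i, j, l, s) /\
  (subst L mz ** dmono V (mw + ml - mz) ** delta (mw + ml - mz)) (i, j, l, s) =
  when [&& s == 0, l == j & 1 <= j] (L (i + j)).
Proof.
refine (dmul_when (d1 := i + j - 1) (d2 := 1) (d3 := 1) (d4 := 0) _
          (Lz_mono _ _ _ _) (delta_wlz _ _ _ _) _ _).
- by move=> k1 k2 k3 k4; rewrite Lz_mono delta_wlz => /when_neq0 h /when_neq0; lia.
- by lia.
- by rewrite mulr1; have -> : i + j - 1 + 1 = i + j by lia.
Qed.

Lemma Lwl_delta i j l s :
  dmul_fin (subst L (mw + ml)) (delta (mw + ml - mz)) (i, j, l, s) /\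
  (subst L (mw + ml) ** delta (mw + ml - mz)) (i, j, l, s) =
  when [&& s == 0, l == j & i <= 0] (L (i + j)).
Proof.
refine (dmul_when (d1 := 0) (d2 := i + j) (d3 := i + j) (d4 := 0) _
          (subst_wl _ _ _ _ _) (delta_wlz _ _ _ _) _ _).
- by move=> k1 k2 k3 k4; rewrite subst_wl delta_wlz => /when_neq0 h /when_neq0; lia.
- by lia.
- by rewrite mulr1.
Qed.

Lemma adler1_rhsE i j l s : adler1_rhs L (i, j, l, s) =
  (when [&& s == j, l == - i & 1 <= j] (shz l (L (i + j))))
  - (when [&& s == - i, l == - i & i <= 0] (shz l (L (i + j))))
  - ((when [&& s == 0, l == j & 1 <= j] (L (i + j)))
     - (when [&& s == 0, l == j & i <= 0] (L (i + j)))).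
Proof.
have [f1 e1] := delta_mono_Sadj i j l s; have [f2 e2] := delta_Lw i j l s.
have [f3 e3] := Lz_mono_delta i j l s; have [f4 e4] := Lwl_delta i j l s.
by rewrite /adler1_rhs /= dmulBr // dmulBl // e1 e2 e3 e4.
Qed.

(** Application to 1 forgets the exponent of S, which each guard fixes to a single value d. *)
Lemma applied_when (W : zmodType) (d : int) (c : bool) (x : W) :
  fin_supp (fun s => when ((s == d) && c) x) /\
  zsum (fun s => when ((s == d) && c) x) = when c x.
Proof.
split; last by rewrite (@zsum1 _ d) ?eqxx // => s /negPf->.
by exists `|d| => s; have [->|sd] := eqVneq s d; [lia | rewrite /when eqxx].
Qed.

End AdlerCoefficients.

(** * The flow of h_n *)

Section Hierarchy.
Variables (F : fieldType) (V : mPVA F).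
Implicit Types (A B L M : pdop V) (i j l n : int).

Lemma fin_suppZ (c : F) (f : int -> V) : fin_supp f -> fin_supp (fun i => c *: f i).
Proof.
move=> [N fN]; exists N => i h; apply: fN.
by apply: contraNneq h => ->; rewrite scaler0.
Qed.

Lemma zsumZ (c : F) (f : int -> V) : fin_supp f ->
  zsum (fun i => c *: f i) = c *: zsum f.
Proof. by move=> ff; rewrite (zsum_raddf (scalerBr c)). Qed.

Lemma br_adler2 L i j l : adler2 L -> br (L i) (L j) l =
  when (l <= j - i) (L (i + l) * shz l (L (j - l)))
  - when (0 <= l) (L (i + l) * shz l (L (j - l)))
  - (2%:R^-1 : F) *:
    (when (l == j - i) (L j * shz l (L i)) - when (l == j) (L j * shz l (L i))
     - (when (l == 0) (L j * shz l (L i)) - when (l == 0 - i) (L j * shz l (L i)))).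
Proof.
move->; rewrite /applied -/(zsum _).
rewrite (eq_zsum (adler2_rhsE L i j l)).
set x := L (i + l) * _; set y := L j * _.
have [f1 e1] := applied_when j (l <= j - i) x.
have [f2 e2] := applied_when l (0 <= l) x.
have [f3 e3] := applied_when j (l == j - i) y.
have [f4 e4] := applied_when j (l == j) y.
have [f5 e5] := applied_when 0 (l == 0) y.
have [f6 e6] := applied_when 0 (l == 0 - i) y.
have f7 := fin_suppB f3 f4; have f8 := fin_suppB f5 f6; have f9 := fin_suppB f7 f8.
rewrite zsumB ?zsumZ; [|exact: f9|exact: fin_suppB|exact: fin_suppZ].
by rewrite !zsumB // e1 e2 e3 e4 e5 e6.
Qed.

Lemma br_adler1 L i j l : adler1 L -> br (L i) (L j) l =
  when ((l == - i) && (1 <= j)) (shz l (L (i + j)))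
  - when ((l == - i) && (i <= 0)) (shz l (L (i + j)))
  - (when ((l == j) && (1 <= j)) (L (i + j)) - when ((l == j) && (i <= 0)) (L (i + j))).
Proof.
move->; rewrite /applied -/(zsum _).
rewrite (eq_zsum (adler1_rhsE L i j l)).
set x := shz _ _; set y := L _.
have [f1 e1] := applied_when j ((l == - i) && (1 <= j)) x.
have [f2 e2] := applied_when (- i) ((l == - i) && (i <= 0)) x.
have [f3 e3] := applied_when 0 ((l == j) && (1 <= j)) y.
have [f4 e4] := applied_when 0 ((l == j) && (i <= 0)) y.
have f5 := fin_suppB f1 f2; have f6 := fin_suppB f3 f4.
by rewrite !zsumB // e1 e2 e3 e4.
Qed.

Lemma whenM_neq0 (c : bool) (x y : V) : when c x * y != 0 -> [/\ c, x != 0 & y != 0].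
Proof.
move=> h; split; last exact: mulr_neq0r h.
  exact: when_neq0 (mulr_neq0l h).
by apply: contraNneq h => ->; rewrite /when if_same mul0r.
Qed.

Lemma zsum_whenM d (c : int -> bool) (x y : int -> V) :
  zsum (fun l => when ((l == d) && c l) (x l) * y l) = when (c d) (x d * y d).
Proof.
rewrite (@zsum1 _ d) => [|l /negPf->]; last by rewrite /when mul0r.
by rewrite eqxx /when; case: (c d); rewrite ?mul0r.
Qed.

(** * Summation of the Adler coefficients against an operator M commuting with L *)

Section Flow.
Variables (s : bool) (L M : pdop V) (j : int).
Hypotheses (hL : sided s L) (hM : sided s M) (LM : pmul L M = pmul M L).

(** The weight with which the coefficient of lambda^l in {L_i lambda L_j} enters
    [vres (L j) L M]. *)
Let T i l := shz l (shz i (M (- i))).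

Let T_neq0 i l : T i l != 0 -> M (- i) != 0.
Proof. by move=> /shz_neq0/shz_neq0. Qed.

Let X i l := L (i + l) * shz l (L (j - l)).

Let X_fin (c : int -> int -> bool) : fin_supp2 (fun i l => when (c i l) (X i l) * T i l).
Proof.
case: hL hM => [a hA] [b hB].
(* The indices i + l, j - l and - i of L, L and M add up to j and are bounded on the same side,
   whatever the guard; the factor 4 leaves room. *)
exists ((`|a| + `|b| + `|j|) * 4) => i l /whenM_neq0[_ hx /T_neq0/hB].
have := hA _ (mulr_neq0l hx); have := hA _ (shz_neq0 (mulr_neq0r hx)).
by case: s; lia.
Qed.

Let Y i l := L j * shz l (L i).

(** L_i and M_(-i) bound i on both sides, and the guard makes l an affine function of i. *)
Let Y_fin (d : int -> int) (e k : int) : (forall i, d i = e * i + k) -> `|e| <= 1 ->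
  fin_supp2 (fun i l => when (l == d i) (Y i l) * T i l).
Proof.
move=> dE e1; case: hL hM => [a hA] [b hB].
exists ((`|a| + `|b| + `|j| + `|k|) * 4) => i l /whenM_neq0[/eqP hd hx /T_neq0/hB].
have := hA _ (shz_neq0 (mulr_neq0r hx)); move: hd; rewrite dE.
have : [|| e == 0, e == 1 | e == -1] by lia.
by case/or3P => /eqP->; case: s; lia.
Qed.

Let Z_fin (c : int -> bool) (d : int -> int) (Z : int -> int -> V) (e k : int) :
  (forall i, d i = e * i + k) -> `|e| <= 1 ->
  (forall i l, Z i l != 0 -> L (i + j) != 0) ->
  fin_supp2 (fun i l => when ((l == d i) && c i) (Z i l) * T i l).
Proof.
move=> dE e1 hZ; case: hL hM => [a hA] [b hB].
exists ((`|a| + `|b| + `|j| + `|k|) * 4) => i l /whenM_neq0[/andP[/eqP hd _] hx /T_neq0/hB].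
have := hA _ (hZ _ _ hx); move: hd; rewrite dE.
have : [|| e == 0, e == 1 | e == -1] by lia.
by case/or3P => /eqP->; case: s; lia.
Qed.

(** With p = i + l the cut-off becomes p <= j, and the sum over l yields S^p of the coefficient of M
    L at j - p. The cut-off thus keeps the positive part of the right factor. *)
Let sum_X_le : zsum (fun i => zsum (fun l => when (l <= j - i) (X i l) * T i l)) =
  pmul L (ppos (pmul L M)) j.
Proof.
rewrite zsum_exchange; last exact: X_fin.
pose u (l p : int) := when (p <= j) (L p * shz l (L (j - l)))
  * shz p (M (l - p)).
have uF : fin_supp2 u.
  case: hL hM => [a hA] [b hB]; exists ((`|a| + `|b| + `|j|) * 4) => l p.
  case/whenM_neq0=> _ hx /shz_neq0/hB.
  have := hA _ (mulr_neq0l hx); have := hA _ (shz_neq0 (mulr_neq0r hx)).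
  by case: s; lia.
transitivity (zsum (fun l => zsum (u l))).
  apply: eq_zsum => l; rewrite (zsum_shift (- l)); apply: eq_zsum => p.
  rewrite /u /X /T -shzD.
  have -> : l + (p - l) = p by lia.
  have -> : p - l + l = p by lia.
  have -> : - (p - l) = l - p by lia.
  by rewrite (_ : (l <= _) = (p <= j)) //; lia.
rewrite zsum_exchange //; apply: eq_zsum => p.
rewrite /ppos /u /when subr_ge0; case: ifP => _; last first.
  by rewrite rmorph0 mulr0 (@zsum1 _ 0) => [|l _]; rewrite mul0r.
rewrite LM pmulE (zsum_raddf (rmorphB _)); last exact: (pmul_fin _ hM hL).
rewrite (zsum_raddf (mulrBr _)); last first.
  have [N hN] := pmul_fin (j - p) hM hL.
  by exists N => m /shz_neq0/hN.
rewrite [RHS](zsum_shift (- p)); apply: eq_zsum => l.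
rewrite rmorphM /= -shzD.
have -> : p + (l - p) = l by lia.
have -> : j - p - (l - p) = j - l by lia.
by ring.
Qed.

(** For fixed l the sum over i yields the coefficient of L M at l, so the cut-off keeps the positive
    part of the left factor. *)
Let sum_X_ge : zsum (fun i => zsum (fun l => when (0 <= l) (X i l) * T i l)) =
  pmul (ppos (pmul L M)) L j.
Proof.
rewrite zsum_exchange; last exact: X_fin.
apply: eq_zsum => l; rewrite (zsum_shift (- l)) /ppos /when.
case: ifP => _; last by rewrite mul0r (@zsum1 _ 0) => [|i _]; rewrite mul0r.
rewrite pmulE (zsum_raddf (phi := *%R^~ _)); last exact: (pmul_fin _ hL hM).
  apply: eq_zsum => p; rewrite /X /T -shzD.
  have -> : l + (p - l) = p by lia.
  have -> : p - l + l = p by lia.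
  have -> : - (p - l) = l - p by lia.
  by rewrite mulrAC.
by move=> x y /=; rewrite mulrBl.
Qed.

(** On l = e - i the two shifts of M combine to S^e, which leaves the residue of M L; on l = e, in
    [sum_Y_const], it is the residue of L M. *)
Let sum_Y_rev e : zsum (fun i => zsum (fun l => when (l == e - i) (Y i l) * T i l)) =
  L j * shz e (pmul M L 0).
Proof.
rewrite pmulE (zsum_raddf (rmorphB _)); last exact: (pmul_fin _ hM hL).
rewrite (zsum_raddf (mulrBr _)); last first.
  have [N hN] := pmul_fin 0 hM hL; by exists N => m /shz_neq0/hN.
rewrite [RHS](@zsum_reindex _ -%R -%R); try exact: opprK.
apply: eq_zsum => i; under eq_zsum do rewrite -[_ == _]andbT.
rewrite (zsum_whenM (e - i) (fun=> true)) /when /Y /T rmorphM /= -!shzD subrK.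
have -> : 0 - - i = i by lia.
by ring.
Qed.

Let sum_Y_const e : zsum (fun i => zsum (fun l => when (l == e) (Y i l) * T i l)) =
  L j * shz e (pmul L M 0).
Proof.
rewrite pmulE (zsum_raddf (rmorphB _)); last exact: (pmul_fin _ hL hM).
rewrite (zsum_raddf (mulrBr _)); last first.
  have [N hN] := pmul_fin 0 hL hM; by exists N => m /shz_neq0/hN.
apply: eq_zsum => i; under eq_zsum do rewrite -[_ == _]andbT.
by rewrite (zsum_whenM e (fun=> true)) /when /Y /T rmorphM /= sub0r mulrA.
Qed.

(** This is -[(L M)_+, L]; the sign is compensated by the one in h_n. For M = L^m the operator L M
    is L^(m+1). *)
Lemma vres_adler2 : adler2 L ->
  vres (L j) L M = pmul L (ppos (pmul L M)) j - pmul (ppos (pmul L M)) L j.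
Proof.
move=> hA; rewrite -sum_X_le -sum_X_ge.
have f1 := X_fin (fun i l => l <= j - i).
have f2 := X_fin (fun i l => 0 <= l).
have f3 : fin_supp2 (fun i l => when (l == j - i) (Y i l) * T i l).
  by apply: (@Y_fin _ (-1) j) => // i; rewrite mulN1r addrC.
have f4 : fin_supp2 (fun i l => when (l == j) (Y i l) * T i l).
  by apply: (@Y_fin _ 0 j) => // i; rewrite mul0r add0r.
have f5 : fin_supp2 (fun i l => when (l == 0) (Y i l) * T i l).
  by apply: (@Y_fin _ 0 0) => // i; rewrite mul0r add0r.
have f6 : fin_supp2 (fun i l => when (l == 0 - i) (Y i l) * T i l).
  by apply: (@Y_fin _ (-1) 0) => // i; rewrite mulN1r addrC.
have f7 := fin_supp2B f3 f4; have f8 := fin_supp2B f5 f6; have f9 := fin_supp2B f7 f8.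
set g := (fun i l => _ - (_ - _)) in f9.
have f10 : fin_supp2 (fun i l => (2%:R^-1 : F) *: g i l).
  case: f9 => N hN; exists N => i l h; apply: hN.
  by apply: contraNneq h => ->; rewrite scaler0.
have -> : vres (L j) L M = zsum (fun i => zsum (fun l =>
    when (l <= j - i) (X i l) * T i l - when (0 <= l) (X i l) * T i l -
    (2%:R^-1 : F) *: g i l)).
  apply: eq_zsum => i; apply: eq_zsum => l.
  by rewrite (br_adler2 _ _ _ hA) !mulrBl -scalerAl !mulrBl.
rewrite (zsum2B (fin_supp2B f1 f2) f10) (zsum2B f1 f2) -[RHS]subr0; congr (_ - _).
(* The half terms sum to 0: for e = j and for e = 0, L_j S^e(mRes(M L)) cancels L_j S^e(mRes(L
   M)). *)
transitivity ((2%:R^-1 : F) *: zsum (fun i => zsum (g i))).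
  rewrite -zsumZ; last exact: fin_supp_zsum.
  by apply: eq_zsum => i; rewrite zsumZ //; apply: fin_supp2_row.
rewrite /g (zsum2B f7 f8) (zsum2B f3 f4) (zsum2B f5 f6).
rewrite (sum_Y_rev j) (sum_Y_const j) (sum_Y_const 0) (sum_Y_rev 0) LM.
by rewrite !subrr scaler0.
Qed.

Let sum_rev_all :
  zsum (fun i => zsum (fun l =>
    when ((l == - i) && (1 <= j)) (shz l (L (i + j))) * T i l)) =
  when (1 <= j) (pmul L M j).
Proof.
transitivity (zsum (fun i => when (1 <= j) (shz (- i) (L (i + j)) * T i (- i)))).
  by apply: eq_zsum => i; rewrite (zsum_whenM (- i) (fun=> 1 <= j)).
rewrite LM pmulE /when; case: ifP => _; last by rewrite (@zsum1 _ 0).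
rewrite [RHS](@zsum_reindex _ -%R -%R); try exact: opprK.
apply: eq_zsum => i; rewrite /T -shzD addNr shz0 opprK [j + i]addrC.
by ring.
Qed.

(** The guard i <= 0 says that the index - i of M is nonnegative, whence the positive part of M
    alone. *)
Let sum_rev_le :
  zsum (fun i => zsum (fun l =>
    when ((l == - i) && (i <= 0)) (shz l (L (i + j))) * T i l)) = pmul (ppos M) L j.
Proof.
transitivity (zsum (fun i => when (i <= 0) (shz (- i) (L (i + j)) * T i (- i)))).
  by apply: eq_zsum => i; rewrite (zsum_whenM (- i) (fun=> i <= 0)).
rewrite pmulE [RHS](@zsum_reindex _ -%R -%R); try exact: opprK.
apply: eq_zsum => i; rewrite /ppos /when oppr_ge0; case: ifP => _; last by rewrite mul0r.
by rewrite /T -shzD addNr shz0 opprK [j + i]addrC mulrC.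
Qed.

Let sum_const_all :
  zsum (fun i => zsum (fun l =>
    when ((l == j) && (1 <= j)) (L (i + j)) * T i l)) = when (1 <= j) (pmul L M j).
Proof.
transitivity (zsum (fun i => when (1 <= j) (L (i + j) * T i j))).
  by apply: eq_zsum => i; rewrite (zsum_whenM j (fun=> 1 <= j) (fun=> L (i + j))).
rewrite pmulE /when; case: ifP => _; last by rewrite (@zsum1 _ 0).
rewrite [RHS](zsum_shift j); apply: eq_zsum => i; rewrite /T -shzD [j + i]addrC.
by have -> : j - (i + j) = - i by lia.
Qed.

Let sum_const_le :
  zsum (fun i => zsum (fun l =>
    when ((l == j) && (i <= 0)) (L (i + j)) * T i l)) = pmul L (ppos M) j.
Proof.
transitivity (zsum (fun i => when (i <= 0) (L (i + j) * T i j))).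
  by apply: eq_zsum => i; rewrite (zsum_whenM j (fun=> i <= 0) (fun=> L (i + j))).
rewrite pmulE [RHS](zsum_shift j); apply: eq_zsum => i.
have -> : j - (i + j) = - i by lia.
rewrite /ppos /when oppr_ge0; case: ifP => _; last by rewrite rmorph0 mulr0.
by rewrite /T -shzD [j + i]addrC.
Qed.

(** The two terms cut off by 1 <= j give coefficients of M L and L M and cancel. What remains
    involves M_+ rather than (L M)_+, hence the exponent n - 1 in the 1-Adler hierarchy. *)
Lemma vres_adler1 : adler1 L ->
  vres (L j) L M = pmul L (ppos M) j - pmul (ppos M) L j.
Proof.
move=> hA.
have f1 : fin_supp2 (fun i l => when ((l == - i) && (1 <= j)) (shz l (L (i + j))) * T i l).
  apply: (@Z_fin (fun=> 1 <= j) _ (fun i l => shz l (L (i + j))) (-1) 0) => [i||i l] //.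
    by rewrite mulN1r addr0.
  exact: shz_neq0.
have f2 : fin_supp2 (fun i l => when ((l == - i) && (i <= 0)) (shz l (L (i + j))) * T i l).
  apply: (@Z_fin (fun i => i <= 0) _ (fun i l => shz l (L (i + j))) (-1) 0) => [i||i l] //.
    by rewrite mulN1r addr0.
  exact: shz_neq0.
have f3 : fin_supp2 (fun i l => when ((l == j) && (1 <= j)) (L (i + j)) * T i l).
  apply: (@Z_fin (fun=> 1 <= j) _ (fun i l => L (i + j)) 0 j) => [i||i l] //.
  by rewrite mul0r add0r.
have f4 : fin_supp2 (fun i l => when ((l == j) && (i <= 0)) (L (i + j)) * T i l).
  apply: (@Z_fin (fun i => i <= 0) _ (fun i l => L (i + j)) 0 j) => [i||i l] //.
  by rewrite mul0r add0r.
transitivity (zsum (fun i => zsum (fun l =>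
    (when ((l == - i) && (1 <= j)) (shz l (L (i + j))) * T i l
     - when ((l == - i) && (i <= 0)) (shz l (L (i + j))) * T i l)
    - (when ((l == j) && (1 <= j)) (L (i + j)) * T i l
       - when ((l == j) && (i <= 0)) (L (i + j)) * T i l)))).
  apply: eq_zsum => i; apply: eq_zsum => l.
  by rewrite (br_adler1 _ _ _ hA) !mulrBl.
rewrite (zsum2B (fin_supp2B f1 f2) (fin_supp2B f3 f4)) (zsum2B f1 f2) (zsum2B f3 f4).
rewrite sum_rev_all sum_rev_le sum_const_all sum_const_le.
by ring.
Qed.

End Flow.

End Hierarchy.

(** * Involution and compatibility *)

Section Functionals.
Variables (F : fieldType) (V : mPVA F).
Implicit Types (a b h k x : V) (A B L P : pdop V).

Lemma fint_eq0 a : a \in @im_shiftB1 F V -> fint a = 0.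
Proof.
move=> ha; have -> : fint a = fint 0.
  by apply/eqP; rewrite -Quotient.idealrBE subr0.
exact: (raddf0 (\pi_(Quotient.quot (@im_shiftB1 F V)))%qT).
Qed.

Lemma im_shiftB1_scale (c : F) a : a \in @im_shiftB1 F V -> c *: a \in @im_shiftB1 F V.
Proof.
by move=> /asboolP[k ->]; apply/asboolP; exists (c *: k); rewrite linearZ scalerBr.
Qed.

Lemma im_shiftB1_shz n x : shz n x - x \in @im_shiftB1 F V.
Proof.
move: n; apply: shz_ind => [|n IH|n IH]; first by rewrite shz0 subrr rpred0.
  rewrite -(subrKA (shz n x)) rpredD // shzS.
  by apply/asboolP; exists (shz n x).
rewrite -(subrKA (shz (n + 1) x)) rpredD // -opprB rpredN shzS.
by apply/asboolP; exists (shz n x).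
Qed.

Lemma im_shiftB1_zsum f : (forall i, f i \in @im_shiftB1 F V) -> zsum f \in @im_shiftB1 F V.
Proof. by move=> hf; rewrite /zsum; apply: rpred_sum. Qed.

(** Cyclicity of \int mRes: A_i S^i(B_(-i)) is S^i of B_(-i) S^(-i)(A_i), so matching terms differ
    by an element of (S - 1)V. *)
Lemma mRes_pcomm s A B : sided s A -> sided s B -> mRes (pcomm A B) \in @im_shiftB1 F V.
Proof.
move=> hA hB; rewrite /mRes /pcomm !pmulE.
rewrite [X in _ - X](@zsum_reindex _ -%R -%R); try exact: opprK.
rewrite -zsumB; last 2 first.
- exact: (pmul_fin _ hA hB).
- have [N hN] := pmul_fin 0 hB hA; exists N => i /hN; lia.
apply: im_shiftB1_zsum => i; rewrite sub0r sub0r opprK.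
have -> : A i * shz i (B (- i)) = shz i (B (- i) * shz (- i) (A i)).
  by rewrite rmorphM /= -shzD addrN shz0 mulrC.
exact: im_shiftB1_shz.
Qed.

Lemma br1Z (c : F) a b : br1 (c *: a) b = c *: br1 a b.
Proof.
rewrite /br1 -!/(zsum _) -zsumZ; last exact: br_supp.
apply: eq_zsum => n; rewrite -[c *: a]addr0 br_linearl.
have -> : br 0 b n = 0 by rewrite -{1}(subrr (0 : V)) br_Bl subrr.
by rewrite addr0.
Qed.

Lemma br1Zr (c : F) a b : br1 a (c *: b) = c *: br1 a b.
Proof.
rewrite /br1 -!/(zsum _) -zsumZ; last exact: br_supp.
apply: eq_zsum => n; rewrite -[c *: b]addr0 br_linearr.
have -> : br a 0 n = 0 by rewrite -{1}(subrr (0 : V)) br_Br subrr.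
by rewrite addr0.
Qed.

Lemma br1_r1 h : br1 h 1 = 0.
Proof.
have := br1_mulr h 1 1; rewrite !mulr1 => /eqP.
by rewrite -subr_eq0 opprD addNKr oppr_eq0 => /eqP.
Qed.

Lemma br1_r0 h : br1 h 0 = 0.
Proof. by rewrite -{1}(subrr (0 : V)) br1_Br subrr. Qed.

Lemma fin_supp2_dep (u : int -> V) (f : int -> int -> V) :
  fin_supp u -> (forall n m, u n = 0 -> f n m = 0) -> (forall n, fin_supp (f n)) ->
  fin_supp2 f.
Proof.
move=> [M hM] hu /choice[N hN].
(* Only rows in the box of M are nonzero, and the sum of their bounds dominates each of them. *)
exists (`|M| + \sum_(n <- zbox M) `|N n|) => n m h.
have nM : - M <= n <= M.
  by apply: hM; apply: contraNneq h => /hu->.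
have nb : n \in zbox M by apply: contraT => /in_zbox; rewrite nM.
have hm := hN _ _ h.
rewrite (big_fsetD1 n) //=; set S := \sum_(_ <- _) _.
have S0 : 0 <= S by apply: sumr_ge0.
by move: S S0 => S S0; apply/andP; split; lia.
Qed.

(** The Jacobi identity at lambda = mu = 1: the coefficientwise axiom is summed over all exponents,
    with p = m - n on the right-hand side. *)
Lemma br1_jacobi a b k : br1 a (br1 b k) - br1 b (br1 a k) = br1 (br1 a b) k.
Proof.
pose h1 (n m : int) := br a (br b k n) m.
pose h2 (m n : int) := br b (br a k m) n.
pose h3 (p n : int) := br (br a b p) k n.
have br0l c n : br 0 c n = 0 :> V by rewrite -{1}(subrr (0 : V)) br_Bl subrr.
have br0r c n : br c 0 n = 0 :> V by rewrite -{1}(subrr (0 : V)) br_Br subrr.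
have f1 : fin_supp2 h1.
  apply: (fin_supp2_dep (br_supp b k)) => [n m E|n]; last exact: br_supp.
  by rewrite /h1 E br0r.
have f2 : fin_supp2 h2.
  apply: (fin_supp2_dep (br_supp a k)) => [n m E|n]; last exact: br_supp.
  by rewrite /h2 E br0r.
have f3 : fin_supp2 h3.
  apply: (fin_supp2_dep (br_supp a b)) => [n m E|n]; last exact: br_supp.
  by rewrite /h3 E br0l.
have -> : br1 a (br1 b k) = zsum (fun n => zsum (h1 n)).
  by rewrite [br1 b k]/(zsum _) br1_sum //; exact: br_supp.
have -> : br1 b (br1 a k) = zsum (fun n => zsum (fun m => h2 m n)).
  rewrite [br1 a k]/(zsum _) br1_sum; last exact: br_supp.
  exact: zsum_exchange f2.
have -> : br1 (br1 a b) k = zsum (fun n => zsum (fun m => h3 (m - n) n)).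
  rewrite [br1 a b]/(zsum _).
  rewrite (zsum_raddf (phi := fun x => br1 x k)); last exact: br_supp.
    rewrite [LHS](zsum_exchange f3); apply: eq_zsum => n.
    exact: (zsum_shift (- n)).
  by move=> x y /=; rewrite br1_Bl.
rewrite -zsum2B //; last first.
  by case: f2 => N hN; exists N => n m /hN/andP[-> ->].
by apply: eq_zsum => n; apply: eq_zsum => m; rewrite /h1 /h2 /h3 br_jacobi.
Qed.

Lemma br1_pmul h A B n s : sided s A -> sided s B ->
  br1 h (pmul A B n) =
  pmul (fun i => br1 h (A i)) B n + pmul A (fun i => br1 h (B i)) n.
Proof.
move=> hA hB.
have hB' : sided s (fun i => br1 h (B i)).
  case: hB => b hb; exists b => i hi; apply: hb.
  by apply: contraNneq hi => ->; rewrite br1_r0.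
suff -> : pmul (fun i => br1 h (A i)) B n =
    br1 h (pmul A B n) - pmul A (fun i => br1 h (B i)) n by rewrite subrK.
rewrite !pmulE br1_sum; last exact: pmul_fin hA hB.
rewrite -zsumB; last exact: pmul_fin hA hB'.
  by apply: eq_zsum => i; rewrite br1_mulr br1_shzr; ring.
have [N hN] := pmul_fin n hA hB; exists N => i hi; apply: hN.
by apply: contraNneq hi => ->; rewrite br1_r0.
Qed.

Lemma pmulBl A A' B n s : sided s A -> sided s A' -> sided s B ->
  pmul (fun i => A i - A' i) B n = pmul A B n - pmul A' B n.
Proof.
move=> hA hA' hB; rewrite !pmulE -zsumB; [|exact: pmul_fin hA hB|exact: pmul_fin hA' hB].
by apply: eq_zsum => i; rewrite mulrBl.
Qed.

Lemma pmulBr A B B' n s : sided s A -> sided s B -> sided s B' ->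
  pmul A (fun i => B i - B' i) n = pmul A B n - pmul A B' n.
Proof.
move=> hA hB hB'; rewrite !pmulE -zsumB; [|exact: pmul_fin hA hB|exact: pmul_fin hA hB'].
by apply: eq_zsum => i; rewrite rmorphB mulrBr.
Qed.

(** Both {\int h, .} and [P, .] are derivations of the operator product, so agreement on L extends
    to its powers. *)
Lemma br1_pexp h s L P : sided s L -> sided s P ->
  (forall j, br1 h (L j) = pcomm P L j) ->
  forall n j, br1 h (pexp L n j) = pcomm P (pexp L n) j.
Proof.
move=> hL hP hE; elim=> [|n IH] j.
  rewrite /pcomm pmul1 p1mul subrr /= /pone.
  by case: eqP; rewrite ?br1_r1 ?br1_r0.
rewrite /= -/(pexp L n); have hX := sided_exp n hL; set X := pexp L n in IH hX *.
have hPL := sided_mul hP hL; have hLP := sided_mul hL hP.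
have hPX := sided_mul hP hX; have hXP := sided_mul hX hP.
have -> : br1 h (pmul L X j) = pmul (pcomm P L) X j + pmul L (pcomm P X) j.
  by rewrite (br1_pmul _ _ hL hX); congr (pmul _ X j + pmul L _ j); apply/funext.
rewrite (pmulBl _ hPL hLP hX) (pmulBr _ hL hPX hXP) /pcomm.
by rewrite !(pmulA hP hL hX) (pmulA hL hP hX) (pmulA hL hX hP) addrA subrK.
Qed.

Lemma sided_in L : in_VSm L \/ in_VSp L -> exists s, sided s L.
Proof.
case=> [[N hN]|[N hN]].
  exists true, N => n; rewrite leNgt; apply: contraNN => /hN->; exact: eqxx.
exists false, (- N) => n; rewrite lerN2 leNgt; apply: contraNN => /hN->; exact: eqxx.
Qed.

Hypothesis charF0 : [pchar F] =i pred0.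

(** The factor m + 1 from the Leibniz rule cancels the denominator of h_(m+1), which is invertible
    in characteristic 0. *)
Lemma br1_hdens s L m a : sided s L ->
  br1 (hdens L m.+1) a = - vres a L (pexp L m).
Proof.
move=> hL; rewrite /hdens /= -scaleNr br1Z (br1_mRes_exp _ _ hL).
have m0 : m.+1%:R != 0 :> F by rewrite (proj1 (pcharf0P F) charF0).
by rewrite -scaler_nat scalerA mulNr mulVf // scaleN1r.
Qed.

(* [q n] is n for the 2-Adler and n - 1 for the 1-Adler hierarchy. *)
Lemma hierarchy s L (q : nat -> nat) : sided s L ->
  (forall m j, br1 (hdens L m.+1) (L j) = pcomm (ppos (pexp L (q m.+1))) L j) ->
  let H n := fint (hdens L n) in
  [/\ forall m n, ham_br (H m) (H n) = 0,
      forall m n, compatible (H m) (H n)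
    & forall n j, (0 < n)%N -> ham_act_symbol (H n) L j = pcomm (ppos (pexp L (q n))) L j].
Proof.
move=> hL hE /=.
have inv m n : ham_br (fint (hdens L m)) (fint (hdens L n)) = 0.
  rewrite ham_br_fint; apply: fint_eq0.
  case: m => [|m]; first by rewrite br10 rpred0.
  case: n => [|n]; first by rewrite br1_r0 rpred0.
  rewrite [hdens L n.+1]/hdens -scaleNr br1Zr; apply: im_shiftB1_scale; rewrite /mRes.
  have hP := sided_ppos (sided_exp (q m.+1) hL).
  rewrite (br1_pexp hL hP (hE m)).
  exact: mRes_pcomm hP (sided_exp _ hL).
split=> // [m n u|[//|n] j _].
  (* The commutator of the two derivations is the action of {\int h_m, \int h_n}, which is 0 by
     involution. *)
  apply/eqP; rewrite -subr_eq0 !ham_act_fint br1_jacobi -ham_act_fint.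
  by rewrite -ham_br_fint inv -(fint_eq0 (rpred0 _)) ham_act_fint br10.
by rewrite /ham_act_symbol ham_act_fint hE.
Qed.

End Functionals.

End Proofs.

Theorem theorem8p4 (F : fieldType) (charF0 : [pchar F]%R =i pred0)
    (V : mPVA F) (L : pdop V) (hL : in_VSm L \/ in_VSp L) :
  let H (n : nat) : functional V := fint (hdens L n) in
  (adler2 L ->
    [/\ (forall m n : nat, ham_br (H m) (H n) = 0%R),
        (forall m n : nat, compatible (H m) (H n)),
        (forall (n : nat) (j : int),
            ham_act_symbol (H n) L j = pcomm (ppos (pexp L n)) L j)
      & (forall m n : nat, integral_of_motion (H m) (H n))]) /\
  (adler1 L ->
    [/\ (forall m n : nat, ham_br (H m) (H n) = 0%R),
        (forall m n : nat, 0 < m -> 0 < n -> compatible (H m) (H n)),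
        (forall (n : nat) (j : int), 0 < n ->
            ham_act_symbol (H n) L j = pcomm (ppos (pexp L n.-1)) L j)
      & (forall m n : nat, 0 < m -> integral_of_motion (H m) (H n))]).
Proof.
have [s sL] := sided_in hL; have LM m := esym (pexpC m sL).
split=> hA.
  have [//|inv com ev] := @hierarchy F V s L id sL.
    move=> m j; rewrite (br1_hdens charF0 _ _ sL).
    by rewrite (vres_adler2 j sL (sided_exp m sL) (LM m) hA) GRing.opprB.
  split=> // n j; case: n => [|n]; last exact: ev.
  (* For n = 0 both sides vanish: h_0 = 0, and (L^0)_+ = 1 commutes with L. *)
  rewrite /ham_act_symbol ham_act_fint br10 /pcomm /=.
  have -> : ppos (pone V) = pone V.
    by apply/boolp.funext => k; rewrite /ppos /pone; case: k => [[|k]|k].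
  by rewrite pmul1 p1mul GRing.subrr.
have [//|inv com ev] := @hierarchy F V s L predn sL.
  move=> m j; rewrite (br1_hdens charF0 _ _ sL).
  by rewrite (vres_adler1 j sL (sided_exp m sL) (LM m) hA) GRing.opprB.
by split=> // m n _; exact: inv.
Qed.
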